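(* For every integer $n\ge 4$, $\mathrm{fr}(n)=12n-16$; that is, from any collection of $12n-16$ colored cubes (arbitrary varieties, repetitions allowed) one can always build the frame of an $n\times n\times n$ cube.
   Context: Fix a palette of six colors. A colored cube is a unit cube each of whose six faces is painted with a single color, every one of the six colors appearing on some face. Two colored cubes are of the same variety if one can be rigidly rotated onto the other with colors matching; there are exactly $30$ varieties. The frame of an $n\times n\times n$ cube consists of the $12(n-2)+8=12n-16$ unit positions lying on its edges (corners included); building a frame means placing colored cubes into all these positions so that, on each of the six outer faces of the big cube, all visible unit faces have one common color. $\mathrm{fr}(n)$ denotes the smallest number $N$ such that from any collection of $N$ colored cubes one can select cubes to build an $n\times n\times n$ frame. *)

(* Defs.v *)
From mathcomp Require Import all_boot all_fingroup.

Set Implicit Arguments.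
Unset Strict Implicit.
Unset Printing Implicit Defensive.

Definition color : Type := 'I_6.

(* (i, true) is the face with outward normal e_i, (i, false) the one with
   outward normal - e_i. *)
Definition face : Type := ('I_3 * bool)%type.

(* A colored cube together with the way it currently sits in space. *)
Definition cube : Type :=
  {c : {ffun face -> color} | [forall k : color, exists f : face, c f == k]}.

Definition face_color (c : cube) (f : face) : color := val c f.

(* A symmetry of the cube is a signed permutation matrix, mapping e_i to
   (-1)^(r.2 i) e_(r.1 i). *)
Definition symmetry : Type := ('S_3 * {ffun 'I_3 -> bool})%type.

Definition move_face (r : symmetry) (f : face) : face :=
  (r.1 f.1, f.2 (+) r.2 f.1).

(* The determinant of the signed permutation matrix is
   (-1)^(r.1) * \prod_i (-1)^(r.2 i); rotations are those of determinant 1. *)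
Definition rotation (r : symmetry) : bool :=
  ~~ (odd_perm r.1 (+) \big[addb/false]_(i < 3) r.2 i).

Definition same_variety (c c' : cube) : bool :=
  [exists r : symmetry,
    rotation r && [forall f, face_color c' (move_face r f) == face_color c f]].

Definition position (n : nat) : Type := {ffun 'I_3 -> 'I_n}.

Definition on_outer_face n (d : face) (p : position n) : bool :=
  p d.1 == (if d.2 then n.-1 else 0) :> nat.

(* A unit position lies on an edge of the big cube (possibly at a corner) when
   at least two of its three coordinates are extremal. *)
Definition on_edge n (p : position n) : bool :=
  2 <= #|[set i : 'I_3 | (p i == 0 :> nat) || (p i == n.-1 :> nat)]|.

Definition frame (n : nat) : Type := {p : position n | on_edge p}.

(* s selects distinct members of the collection, and q is how they are turned
   once put in place.  Only the unit faces lying on the outer faces of the big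
   cube are constrained, and nothing is asked of colors of different outer
   faces. *)
Definition can_build n N (c : {ffun 'I_N -> cube}) : bool :=
  [exists s : {ffun frame n -> 'I_N}, exists q : {ffun frame n -> cube},
    [&& injectiveb s,
        [forall p, same_variety (c (s p)) (q p)] &
        [forall d : face, exists k : color, forall p : frame n,
          on_outer_face d (val p) ==> (face_color (q p) d == k)]]].

Definition always_can_build (n N : nat) : bool :=
  [forall c : {ffun 'I_N -> cube}, can_build n c].

Lemma same_variety_refl (c : cube) : same_variety c c.
Proof.
apply/existsP; exists (1%g, [ffun=> false]).
rewrite /rotation /= odd_perm1 big1 => [|i _]; last by rewrite ffunE.
by apply/forallP => -[i b]; rewrite /move_face /= perm1 ffunE addbF.
Qed.

(* With enough cubes, some coloring occurs #|frame n| times. *)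
Lemma ex_always_can_build (n : nat) : exists N, always_can_build n N.
Proof.
exists (#|{: cube}| * #|{: frame n}|).+1; apply/forallP => c.
have [a le_a] : exists a : cube, #|{: frame n}| <= #|[set i | c i == a]|.
  apply/existsP; apply: contraT; rewrite negb_exists => /forallP lt_a.
  have : #|'I_(#|{: cube}| * #|{: frame n}|).+1| <= #|{: cube}| * #|{: frame n}|.
    rewrite -sum1_card (partition_big c xpredT) //=.
    rewrite -[X in _ <= X]sum_nat_const leq_sum // => a _.
    by rewrite sum1_card -cardsE ltnW // ltnNge lt_a.
  by rewrite card_ord ltnn.
pose s := [ffun p : frame n => enum_val (widen_ord le_a (enum_rank p))].
apply/existsP; exists s; apply/existsP; exists [ffun=> a].
have sa p : c (s p) = a.
  by have := enum_valP (widen_ord le_a (enum_rank p)); rewrite inE ffunE => /eqP.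
apply/and3P; split.
- apply/injectiveP => p p'; rewrite !ffunE => /enum_val_inj [].
  by move/val_inj/enum_rank_inj.
- by apply/forallP => p; rewrite sa ffunE same_variety_refl.
- apply/forallP => d; apply/existsP; exists (face_color a d).
  by apply/forallP => p; rewrite ffunE eqxx implybT.
Qed.

Definition fr (n : nat) : nat := ex_minn (ex_always_can_build n).

(* Main.v *)
Require Import Defs.
From mathcomp Require Import all_boot all_fingroup zify.

(* Let the big cube have variety t.  A cube fits on an edge of it unless the two
   colors of the edge are opposite on the cube, so a cube fails on at most three
   of the twelve edges; and a cube of another variety has either no corner or
   two corners in common with t.  With k = n - 2, all 12 k + 8 cubes have to be
   used, and Hall's theorem reduces this to filling the corners, provided that
   no pair of colors adjacent on t is opposite on more than 11 k cubes, and that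
   no matching of opposite colors, other than that of t, is shared by more than
   9 k cubes.  If one of these bounds is exceeded, the popular matching or pair
   of colors directs us to a heavily represented t.  Otherwise only the corners
   matter.  Seen on t, the cubes of the other varieties are the edges of a graph
   on its 8 corners, and the corners can be filled iff the cubes of variety t
   are at least as many as the components of this graph that are trees.  That
   some t has this property as soon as there are 32 cubes is shown by a search
   over boxes of weights, which are pruned by monotonicity and by the symmetry
   under permutations of the colors. *)

Set Implicit Arguments.
Unset Strict Implicit.
Unset Printing Implicit Defensive.

(** * Weights and involutions *)

Lemma all_iota_ord n (P : pred nat) : all P (iota 0 n) -> forall i : 'I_n, P i.
Proof. by move=> /allP Pn i; apply: Pn; rewrite mem_iota /=. Qed.

Lemma all2_iota_ord n p (P : nat -> nat -> bool) :
  all (fun i => all (P i) (iota 0 p)) (iota 0 n) ->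
  forall (i : 'I_n) (j : 'I_p), P i j.
Proof. by move=> /all_iota_ord Pn i; apply: all_iota_ord (Pn i). Qed.

Definition weight (I : finType) (m : I -> nat) (A : {set I}) : nat :=
  \sum_(i in A) m i.

Section Weight.

Variable I : finType.
Implicit Types (m : I -> nat) (A B : {set I}).

Lemma weight0 m : weight m set0 = 0.
Proof. exact: big_set0. Qed.

Lemma weightID m A B : weight m A = weight m (A :&: B) + weight m (A :\: B).
Proof. exact: big_setID. Qed.

Lemma weightS m A B : A \subset B -> weight m A <= weight m B.
Proof. by move=> /setIidPr AB; rewrite (weightID m B A) AB leq_addr. Qed.

Lemma weightU m A B : weight m (A :|: B) <= weight m A + weight m B.
Proof.
rewrite (weightID m _ A) setUK setDUl setDv set0U leq_add2l.
exact: weightS (subsetDl B A).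
Qed.

Lemma weight_disjoint m A B :
  [disjoint A & B] -> weight m A + weight m B <= weight m setT.
Proof.
move=> dAB; rewrite (weightID m setT A) setTI leq_add2l weightS //.
by rewrite subsetD subsetT disjoint_sym.
Qed.

Lemma leq_weight m m' A : (forall i, m i <= m' i) -> weight m A <= weight m' A.
Proof. by move=> le_m; apply: leq_sum. Qed.

Lemma weight_incr m A i :
  weight (fun j => m j + (j == i)) A = weight m A + (i \in A).
Proof.
rewrite /weight big_split /=; congr (_ + _); case: (boolP (i \in A)) => Ai.
  by rewrite (bigD1 i) //= eqxx big1 // => j /andP[_ /negbTE->].
by rewrite big1 // => j Aj; case: eqP => // ji; rewrite -ji Aj in Ai.
Qed.

Lemma weight_reindex m A (h : I -> I) :
  injective h -> weight (m \o h) (h @^-1: A) = weight m A.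
Proof.
move=> h_inj; rewrite /weight [RHS](reindex_inj h_inj) /=.
by apply: eq_bigl => i; rewrite inE.
Qed.

Lemma exists_heaviest m A i0 :
  i0 \in A -> exists2 i, i \in A & weight m A <= #|A| * m i.
Proof.
move=> Ai0; have [i Ai max_i] := arg_maxnP m Ai0.
by exists i => //; rewrite -sum_nat_const leq_sum.
Qed.

Lemma weight_preim (J : finType) (f : J -> I) A :
  weight (fun i => #|f @^-1: [set i]|) A = #|f @^-1: A|.
Proof.
rewrite -sum1_card (partition_big f (mem A)) => [|j]; last by rewrite inE.
apply: eq_bigr => i Ai; rewrite -sum1_card; apply: eq_bigl => j.
by rewrite !inE; case: eqVneq => [->|]; rewrite ?Ai ?andbF.
Qed.

End Weight.

Lemma eq_fixfree_involution6 (T : finType) (f g : T -> T) (a b : T) : #|T| <= 6 ->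
  involutive f -> involutive g -> (forall x, f x != x) -> (forall x, g x != x) ->
  f a = g a -> f b = g b -> b != a -> b != f a -> f =1 g.
Proof.
move=> card_T fK gK f_neq g_neq fga fgb ba bfa x.
pose s := [:: a; f a; b; f b].
have [|xs] := boolP (x \in s).
  by rewrite !inE => /or4P[] /eqP ->; rewrite ?fK // (fga, fgb) gK.
have stable h : involutive h -> h a = f a -> h b = f b -> h x \notin s.
  move=> hK ha hb; apply: contra xs; rewrite !inE -ha -hb !(inv_eq hK) !hK.
  by case/or4P=> ->; rewrite ?orbT.
apply: contraTeq card_T => fgx; rewrite -ltnNge.
suff us : uniq [:: f x, g x, x & s].
  by apply: leq_trans (max_card [in [:: f x, g x, x & s]]); rewrite (card_uniqP us).
rewrite !cons_uniq inE negb_or fgx inE negb_or f_neq stable //= inE negb_or.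
rewrite g_neq stable //= xs !inE !negb_or (eq_sym a (f a)) f_neq (eq_sym a b) ba.
rewrite (eq_sym a) (inv_eq fK) bfa (eq_sym (f a) b) bfa.
by rewrite (inj_eq (can_inj fK)) (eq_sym a) ba (eq_sym b) f_neq.
Qed.

(** * Hall's marriage theorem *)

Section Hall.

Variables X Y : finType.
Implicit Types (R : X -> {set Y}) (A S : {set X}) (f g : X -> Y).

Definition neighbours R S : {set Y} := \bigcup_(x in S) R x.

Definition hall_condition R A : Prop :=
  forall S, S \subset A -> #|S| <= #|neighbours R S|.

Definition matching R A f : Prop :=
  {in A &, injective f} /\ {in A, forall x, f x \in R x}.

Lemma neighboursD R (B : {set Y}) S :
  neighbours (fun x => R x :\: B) S = neighbours R S :\: B.
Proof.
apply/setP => y; rewrite inE; apply/bigcupP/andP => [[x Sx] | [yB /bigcupP[x Sx Rxy]]].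
  by rewrite inE => /andP[-> Rxy]; split=> //; apply/bigcupP; exists x.
by exists x => //; rewrite inE yB.
Qed.

Lemma hall_condition_residual R A S : hall_condition R A -> S \subset A ->
  #|neighbours R S| <= #|S| ->
  hall_condition (fun x => R x :\: neighbours R S) (A :\: S).
Proof.
move=> hallA SA tight S'; rewrite subsetD => /andP[S'A dS'].
have := hallA (S' :|: S); rewrite subUset S'A SA => /(_ isT).
rewrite neighboursD cardsU (disjoint_setI0 dS') cards0 subn0 /neighbours bigcup_setU.
by rewrite -!/(neighbours R _) cardsU cardsD; lia.
Qed.

Lemma hall_condition_remove R A x y : x \in A ->
  (forall S, S != set0 -> S \proper A -> #|S| < #|neighbours R S|) ->
  hall_condition (fun z => R z :\ y) (A :\ x).
Proof.
move=> Ax slack S; rewrite subsetD1 => /andP[SA Sx].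
have [->|S_neq0] := eqVneq S set0; first by rewrite cards0.
have /slack -/(_ S_neq0) : S \proper A.
  by rewrite properE SA; apply: contra Sx => /subsetP->.
by rewrite neighboursD (cardsD1 y (neighbours R S)); case: (y \in _) => /=; lia.
Qed.

Lemma matching_glue R A S (B : {set Y}) f g :
  {in S, forall x, f x \in B} -> matching R S f ->
  matching (fun x => R x :\: B) (A :\: S) g ->
  matching R A (fun x => if x \in S then f x else g x).
Proof.
move=> fB [f_inj fR] [g_inj gR].
have gP x : x \in A -> x \notin S -> (g x \notin B) && (g x \in R x).
  by move=> Ax Sx; have := gR x; rewrite !inE Ax Sx; apply.
split=> [x x' Ax Ax' | x Ax]; last first.
  by case: ifPn => [/fR | /(gP x Ax)/andP[]].
case: ifPn => Sx; case: ifPn => Sx'; first exact: f_inj.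
- by move=> eq_fg; have /andP[/negP[]] := gP x' Ax' Sx'; rewrite -eq_fg fB.
- by move=> eq_gf; have /andP[/negP[]] := gP x Ax Sx; rewrite eq_gf fB.
- by apply: g_inj; rewrite inE ?Sx ?Sx'.
Qed.

Theorem hall R A (y0 : Y) : hall_condition R A -> exists f, matching R A f.
Proof.
have [n] := ubnP #|A|; elim: n => // n IHn in R A *; rewrite ltnS => leA hallA.
have [-> | [x Ax]] := set_0Vmem A.
  by exists (fun=> y0); split=> [x | x]; rewrite inE.
case: (boolP [exists S : {set X},
    [&& S != set0, S \proper A & #|neighbours R S| <= #|S|]]).
  case/existsP=> S /and3P[S_neq0 SpA tight]; have SA := proper_sub SpA.
  have [||f fM] := IHn R S; first exact: leq_trans (proper_card SpA) leA.
    by move=> S' S'S; apply: hallA (subset_trans S'S SA).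
  have [|g gM] := IHn _ (A :\: S) _ (hall_condition_residual hallA SA tight).
    rewrite cardsD (setIidPr SA); have := subset_leq_card SA.
    by move: S_neq0 leA; rewrite -card_gt0; lia.
  exists (fun x => if x \in S then f x else g x).
  apply: (matching_glue _ fM gM) => z Sz.
  by apply/bigcupP; exists z => //; apply: fM.2.
rewrite negb_exists => /forallP loose.
have [y Ryx] : exists y, y \in R x.
  by apply/card_gt0P; have := hallA [set x]; rewrite sub1set Ax cards1 /neighbours
    big_set1; apply.
have [||g gM] := IHn (fun z => R z :\ y) (A :\ x).
- by have := cardsD1 x A; rewrite Ax; move: leA; lia.
- apply: hall_condition_remove => // S S_neq0 SA.
  by have := loose S; rewrite S_neq0 SA -ltnNge.
exists (fun z => if z \in [set x] then y else g z).
apply: matching_glue gM => [z _ | ]; first by rewrite inE.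
by split=> [z z' | z]; rewrite !inE => /eqP-> // /eqP->.
Qed.

End Hall.

(** * Trees of a growing graph *)

Definition isolated (V : eqType) (vertices : seq V) : seq (seq V) :=
  [seq [:: x] | x <- vertices].

(* The edge e merges the two trees that it joins, or turns the only tree that it
   meets into a component that is not a tree. *)
Definition add_edge (V : eqType) (e : seq V) (trees : seq (seq V)) : seq (seq V) :=
  let rest := [seq C <- trees | ~~ has (mem e) C] in
  match [seq C <- trees | has (mem e) C] with
  | [:: C] => rest
  | [:: C; D] => (C ++ D) :: rest
  | _ => trees
  end.

Definition add_edges (I : Type) (V : eqType) (edge : I -> seq V) (es : seq I)
    (trees : seq (seq V)) : seq (seq V) :=
  foldr (fun i => add_edge (edge i)) trees es.

Section TreeBound.

Variables (I : finType) (V : eqType) (vertices : seq V) (edge : I -> seq V).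
Implicit Types (l : I -> nat) (trees : seq (seq V)) (S : seq V).

Definition incident S : {set I} := [set i | has (mem (edge i)) S].

(* Take l i copies of the edge i.  If trees lists the vertex sets of the
   components that are trees, a set of vertices has at most one vertex more than
   incident edges for each tree that it contains. *)
Definition tree_bound l trees : Prop :=
  forall S, uniq S -> {subset S <= vertices} ->
    size S <= weight l (incident S) + count (all (mem S)) trees.

Lemma count_add_edge (e : seq V) trees S :
  count (all (mem S)) trees <=
    has (mem e) S + count (all (mem S)) (add_edge e trees).
Proof.
have split_trees : count (all (mem S)) trees =
    count (all (mem S)) [seq C <- trees | has (mem e) C] +
    count (all (mem S)) [seq C <- trees | ~~ has (mem e) C].
  by rewrite -count_cat (seq.permP (permEl (perm_filterC _ _))).
have not_inside C : ~~ has (mem e) S -> has (mem e) C -> all (mem S) C = false.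
  move=> /hasPn eS /hasP[x xC xe]; apply/negbTE/allPn; exists x => //.
  by apply: contraL xe => /eS.
rewrite /add_edge; move: split_trees.
have : all (has (mem e)) [seq C <- trees | has (mem e) C] by rewrite filter_all.
case: [seq C <- trees | has (mem e) C] => [|C [|D [|? ?]]] /=; rewrite ?andbT.
- by move=> _ _; rewrite leq_addl.
- move=> eC ->; rewrite addn0 leq_add2r.
  by case: (boolP (has (mem e) S)) => [_|/not_inside/(_ eC)->] //; case: all.
- case/andP=> eC eD ->; rewrite addn0 addnA leq_add2r all_cat.
  case: (boolP (has (mem e) S)) => [_|nS]; first by case: all; case: all.
  by rewrite !not_inside.
- by move=> _ _; rewrite leq_addl.
Qed.

Lemma tree_bound_isolated l : tree_bound l (isolated vertices).
Proof.
move=> S uS sS; rewrite count_map (eq_count (a2 := mem S)); last first.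
  by move=> x /=; rewrite andbT.
rewrite -size_filter; apply: leq_trans (leq_addl _ _).
by apply: uniq_leq_size => // x xS; rewrite mem_filter /= xS sS.
Qed.

Lemma tree_bound_mono l l' trees :
  (forall i, l i <= l' i) -> tree_bound l trees -> tree_bound l' trees.
Proof.
move=> le_l bound S uS sS; apply: leq_trans (bound S uS sS) _.
by rewrite leq_add2r leq_weight.
Qed.

Lemma tree_bound_add_edge l i trees : tree_bound l trees ->
  tree_bound (fun j => l j + (j == i)) (add_edge (edge i) trees).
Proof.
move=> bound S uS sS; apply: leq_trans (bound S uS sS) _.
by rewrite weight_incr -addnA leq_add2l inE count_add_edge.
Qed.

Lemma tree_bound_add_edges l (es : seq I) trees : tree_bound l trees ->
  tree_bound (fun j => l j + count_mem j es) (add_edges edge es trees).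
Proof.
move=> bound; elim: es => [|i es IHes] /=.
  by apply: tree_bound_mono bound => j; rewrite addn0.
apply: (tree_bound_mono _ (tree_bound_add_edge i IHes)) => j.
by rewrite -addnA leq_add2l addnC eq_sym.
Qed.

End TreeBound.

(** * Varieties and their corners *)

Definition variety : Type := 'I_30.

(* A coloring is the list of the colors of the faces (0, false), (0, true),
   (1, false), (1, true), (2, false), (2, true).  Varieties 2 j and 2 j + 1 are
   mirror images of each other. *)
Definition reps : seq (seq nat) :=
  [:: [:: 0; 1; 2; 3; 4; 5]; [:: 1; 0; 2; 3; 4; 5]; [:: 0; 1; 2; 4; 3; 5];
      [:: 1; 0; 2; 4; 3; 5]; [:: 0; 1; 2; 5; 3; 4]; [:: 1; 0; 2; 5; 3; 4];
      [:: 0; 2; 1; 3; 4; 5]; [:: 2; 0; 1; 3; 4; 5]; [:: 0; 2; 1; 4; 3; 5];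
      [:: 2; 0; 1; 4; 3; 5]; [:: 0; 2; 1; 5; 3; 4]; [:: 2; 0; 1; 5; 3; 4];
      [:: 0; 3; 1; 2; 4; 5]; [:: 3; 0; 1; 2; 4; 5]; [:: 0; 3; 1; 4; 2; 5];
      [:: 3; 0; 1; 4; 2; 5]; [:: 0; 3; 1; 5; 2; 4]; [:: 3; 0; 1; 5; 2; 4];
      [:: 0; 4; 1; 2; 3; 5]; [:: 4; 0; 1; 2; 3; 5]; [:: 0; 4; 1; 3; 2; 5];
      [:: 4; 0; 1; 3; 2; 5]; [:: 0; 4; 1; 5; 2; 3]; [:: 4; 0; 1; 5; 2; 3];
      [:: 0; 5; 1; 2; 3; 4]; [:: 5; 0; 1; 2; 3; 4]; [:: 0; 5; 1; 3; 2; 4];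
      [:: 5; 0; 1; 3; 2; 4]; [:: 0; 5; 1; 4; 2; 3]; [:: 5; 0; 1; 4; 2; 3]].

Definition rep (v : nat) : seq nat := nth [::] reps v.

(* The corner with colors a, b, c in positive order, read from its least color. *)
Definition oriented_corner (a b c : nat) : seq nat :=
  if (a < b) && (a < c) then [:: a; b; c]
  else if b < c then [:: b; c; a] else [:: c; a; b].

Definition corner_at (l : seq nat) (x y z : bool) : seq nat :=
  let a := nth 0 l x in let b := nth 0 l y.+2 in let c := nth 0 l z.+4 in
  if x (+) y (+) z then oriented_corner a b c else oriented_corner b a c.

Definition signs : seq (bool * bool * bool) :=
  [seq (s, z) | s <- [seq (x, y) | x <- [:: false; true], y <- [:: false; true]],
                z <- [:: false; true]].

Definition corners_of (l : seq nat) : seq (seq nat) :=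
  [seq corner_at l s.1.1 s.1.2 s.2 | s <- signs].

Definition corners (v : nat) : seq (seq nat) := corners_of (rep v).

Arguments corners : simpl never.

Definition variety_index (l : seq nat) : nat :=
  find (fun r => all (mem (corners_of r)) (corners_of l)) reps.

Definition varieties : seq nat := iota 0 30.
Arguments varieties : simpl never.

Lemma index_corner v k : k \in corners v -> index k (corners v) \in iota 0 8.
Proof. by rewrite -index_mem mem_iota. Qed.

Lemma corners_uniq (v : variety) : uniq (corners v).
Proof.
by have /all_iota_ord/(_ v) : all (fun v => uniq (corners v)) varieties by vm_compute.
Qed.

(* Hall's condition for filling the corners of a big cube of variety t with m v
   cubes of each variety v. *)
Definition corners_fillable (m : variety -> nat) (t : variety) : Prop :=
  forall S : seq (seq nat), uniq S -> {subset S <= corners t} ->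
    size S <= weight m [set v : variety | has (mem (corners v)) S].

Definition fillable (m : variety -> nat) : Prop := exists t, corners_fillable m t.

(** * Symmetry under recoloring *)

Definition variety_symmetry (g : seq nat) : Prop :=
  size g = 30 /\
  exists2 p : {perm variety}, forall v : variety, nth 0 g v = p v &
    forall m, fillable (m \o p) -> fillable m.

Definition compose (g h : seq nat) : seq nat := [seq nth 0 g i | i <- h].

Lemma variety_symmetry_id : variety_symmetry varieties.
Proof.
split; rewrite ?size_iota //; exists 1%g => [v | m [t mt]].
  by rewrite nth_iota // perm1.
exists t => S uS sS; apply: leq_trans (mt S uS sS) _.
by apply: leq_weight => v; rewrite /= perm1.
Qed.

Lemma variety_symmetry_compose g h :
  variety_symmetry g -> variety_symmetry h -> variety_symmetry (compose g h).
Proof.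
move=> [sz_g [p gE pP]] [sz_h [q hE qP]]; split; first by rewrite size_map.
exists (q * p)%g => [v | m [t mt]]; first by rewrite (nth_map 0) ?sz_h // hE gE permM.
apply: pP; apply: qP; exists t => S uS sS; apply: leq_trans (mt S uS sS) _.
by apply: leq_weight => v; rewrite /= permM.
Qed.

Definition recolor_corner (tau k : seq nat) : seq nat :=
  oriented_corner (nth 0 tau (nth 0 k 0)) (nth 0 tau (nth 0 k 1))
    (nth 0 tau (nth 0 k 2)).

Definition recolor_varieties (tau : seq nat) : seq nat :=
  [seq variety_index [seq nth 0 tau a | a <- l] | l <- reps].

Definition recoloring_involution (tau : seq nat) : bool :=
  let g := recolor_varieties tau in
  all (fun v => [&& nth 0 g v < 30, nth 0 g (nth 0 g v) == v &
    all (fun k => (recolor_corner tau k \in corners (nth 0 g v)) &&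
                  (recolor_corner tau (recolor_corner tau k) == k)) (corners v)])
    varieties.

Lemma recoloring_symmetry tau :
  recoloring_involution tau -> variety_symmetry (recolor_varieties tau).
Proof.
set g := recolor_varieties tau; set f := recolor_corner tau.
move=> /all_iota_ord gP; split; first by rewrite size_map.
pose h (v : variety) : variety := inord (nth 0 g v).
have hE v : h v = nth 0 g v :> nat by have /and3P[lt_gv _ _] := gP v; rewrite inordK.
have hK : involutive h.
  by move=> v; apply: ord_inj; rewrite !hE; have /and3P[_ /eqP] := gP v.
have fP (v : variety) k : k \in corners v -> f k \in corners (h v) /\ f (f k) = k.
  by rewrite hE; have /and3P[_ _ /allP/(_ k)] := gP v => fk /fk/andP[? /eqP].
exists (perm (can_inj hK)) => [v|m [t mt]]; first by rewrite permE hE.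
exists (h t) => S uS sS.
have fS k : k \in S -> f k \in corners t /\ f (f k) = k by move/sS/fP; rewrite hK.
have f_inj : {in S &, injective f}.
  by move=> k k' /fS[_ fk] /fS[_ fk'] eq_f; rewrite -fk eq_f fk'.
have := mt (map f S); rewrite map_inj_in_uniq // size_map => /(_ uS) le_S.
apply: leq_trans (le_S _) _ => [_ /mapP[k /fS[fk _] ->] //|].
rewrite -[leqRHS](weight_reindex _ _ (@perm_inj _ (perm (can_inj hK)))) weightS //.
apply/subsetP=> v; rewrite !inE permE has_map => /hasP[k kS /= /fP[]].
by have [_ ->] := fS k kS => kv _; apply/hasP; exists k.
Qed.

Definition adjacent_swaps : seq (seq nat) :=
  [seq [seq (if i == k then k.+1 else if i == k.+1 then k else i)
       | i <- iota 0 6] | k <- iota 0 5].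

Fixpoint left_products (s : seq (seq nat)) (g : seq nat) : seq (seq nat) :=
  g :: if s is h :: s' then left_products s' (compose h g) else [::].

(* If s lists generators of the symmetric groups S_(k+1), S_k, ... by adjacent
   transpositions, the products over successive cosets exhaust S_(k+1). *)
Fixpoint coset_products (s : seq (seq nat)) : seq (seq nat) :=
  if s is _ :: s' then
    [seq compose g h | g <- left_products s varieties, h <- coset_products s']
  else [:: varieties].

Definition recolorings : seq (seq nat) :=
  coset_products (rev [seq recolor_varieties tau | tau <- adjacent_swaps]).

Lemma left_products_symmetry s g : {in s, forall h, variety_symmetry h} ->
  variety_symmetry g -> {in left_products s g, forall h, variety_symmetry h}.
Proof.
elim: s g => [|h s IHs] g sP gP f /=; rewrite inE; first by move/eqP->.
case/predU1P=> [-> //|]; apply: IHs => [h' sh'|].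
  by apply: sP; rewrite inE sh' orbT.
by apply: variety_symmetry_compose gP; apply: sP; rewrite mem_head.
Qed.

Lemma coset_products_symmetry s : {in s, forall g, variety_symmetry g} ->
  {in coset_products s, forall g, variety_symmetry g}.
Proof.
elim: s => [|g s IHs] sP f; first by rewrite inE => /eqP->; apply: variety_symmetry_id.
case/allpairsP=> -[h h'] [/= hP h'P ->]; apply: variety_symmetry_compose.
  exact: left_products_symmetry sP variety_symmetry_id _ hP.
by apply: IHs h'P => k ks; apply: sP; rewrite inE ks orbT.
Qed.

Lemma recolorings_symmetry : {in recolorings, forall g, variety_symmetry g}.
Proof.
apply: coset_products_symmetry => g; rewrite mem_rev => /mapP[tau tau_swap ->].
by apply: recoloring_symmetry; move: tau tau_swap; apply/allP; vm_compute.
Qed.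

(** * Tree components of the shared corners *)

(* The corners of t are numbered from 0 to 7, in the order of corners t. *)
Definition shared_corners (t v : nat) : seq nat :=
  [seq i <- iota 0 8 | nth [::] (corners t) i \in corners v].

(* Tabulated because the search looks it up at every step. *)
Definition link_table : seq (seq (seq nat)) := Eval vm_compute in
  [seq [seq if t == v then [::] else shared_corners t v | v <- varieties]
  | t <- varieties].

Definition links (t v : nat) : seq nat := nth [::] (nth [::] link_table t) v.

Lemma linksE (t v : variety) :
  links t v = if t == v then [::] else shared_corners t v.
Proof.
have /all2_iota_ord/(_ t v)/eqP // : all (fun t => all (fun v =>
  links t v == if t == v then [::] else shared_corners t v) varieties) varieties.
by vm_compute.
Qed.

Lemma has_links (t v : variety) (S : seq (seq nat)) : {subset S <= corners t} ->
  has (mem (links t v)) [seq index k (corners t) | k <- S] =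
  (v != t) && has (mem (corners v)) S.
Proof.
move=> sS; rewrite linksE eq_sym has_map.
case: (v == t) => /=; first by apply/hasP => -[].
apply: eq_in_has => k /sS kt /=.
by rewrite mem_filter nth_index // index_corner // andbT.
Qed.

Definition corner_tree_bound (t : variety) :
    (variety -> nat) -> seq (seq nat) -> Prop :=
  tree_bound (iota 0 8) (fun v : variety => links t v).

Lemma corner_tree_bound_add_edges (t : variety) l (es : seq variety) trees :
  corner_tree_bound t l trees ->
  corner_tree_bound t (fun v => l v + count_mem v es)
    (add_edges (links t) [seq val v | v <- es] trees).
Proof. by move/(tree_bound_add_edges es); rewrite /add_edges foldr_map. Qed.

Lemma tree_bound_fillable (t : variety) l m trees : (forall v, l v <= m v) ->
  corner_tree_bound t l trees -> size trees <= m t -> corners_fillable m t.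
Proof.
move=> le_l bound le_trees S uS sS; case: (posnP (size S)) => [->//|S_gt0].
have index_inj : {in S &, injective (index^~ (corners t))}.
  by move=> x y /sS xt /sS yt eq_xy; rewrite -(nth_index [::] xt) eq_xy nth_index.
have := bound [seq index k (corners t) | k <- S].
rewrite size_map map_inj_in_uniq // => /(_ uS) le_S; apply: leq_trans (le_S _) _.
  by move=> _ /mapP[k /sS kt ->]; apply: index_corner.
set A := [set v : variety | _].
have At : t \in A.
  rewrite inE; case: S S_gt0 sS {uS index_inj le_S A} => // k S _ sS.
  by rewrite /= sS ?mem_head.
rewrite (weightID m A [set t]) (setIidPr _) ?sub1set // /weight big_set1 addnC.
apply: leq_add; first exact: leq_trans (count_size _ _) le_trees.
apply: leq_trans (leq_weight _ le_l) _; apply: weightS; apply/subsetP => v.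
by rewrite !inE has_links.
Qed.

Lemma cubes_fillable (m : variety -> nat) (t : variety) (es : seq variety) :
  (forall v, count_mem v es <= m v) ->
  size (add_edges (links t) [seq val v | v <- es] (isolated (iota 0 8))) <= m t ->
  corners_fillable m t.
Proof.
move=> le_m; apply: (@tree_bound_fillable t (fun v => 0 + count_mem v es)) => //.
exact/corner_tree_bound_add_edges/tree_bound_isolated.
Qed.

Lemma heavy_fillable (m : variety -> nat) t : 8 <= m t -> corners_fillable m t.
Proof. exact: (@cubes_fillable m t [::]). Qed.

(** * Exhaustive search over boxes of weights *)

Definition tabulate (T : Type) (f : nat -> T) : seq T := [seq f v | v <- varieties].

Lemma nth_tabulate T (x0 : T) f (v : variety) : nth x0 (tabulate f) v = f v.
Proof. by rewrite (nth_map 0) ?size_iota // nth_iota. Qed.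

Lemma sumn_tabulate f : sumn (tabulate f) = \sum_(v : variety) f v.
Proof. by rewrite sumnE big_map -[varieties]/(index_iota 0 30) big_mkord. Qed.

Definition in_box (lo hi : seq nat) (m : variety -> nat) : Prop :=
  forall v : variety, nth 0 lo v <= m v <= nth 0 hi v.

(* forests lists, for each t, the trees left by the lower bounds lo. *)
Definition forests_bound (lo : seq nat) (forests : seq (seq (seq nat))) : Prop :=
  forall t : variety,
    corner_tree_bound t (fun v => nth 0 lo v) (nth [::] forests t).

Definition settled (lo : seq nat) (forests : seq (seq (seq nat))) : bool :=
  has (fun t => size (nth [::] forests t) <= nth 0 lo t) varieties.

(* Weights beyond the new upper bounds make some t fillable: either one more
   cube of variety v removes the only tree in excess of the cubes of variety t,
   or v itself has as many cubes as trees. *)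
Definition prune (lo hi : seq nat) (forests : seq (seq (seq nat))) : seq nat :=
  let one_short :=
    [seq t <- varieties | size (nth [::] forests t) == (nth 0 lo t).+1] in
  tabulate (fun v =>
    if has (fun t => size (add_edge (links t v) (nth [::] forests t)) <= nth 0 lo t)
         one_short then nth 0 lo v
    else minn (nth 0 hi v) (size (nth [::] forests v)).-1).

Definition fixes (s g : seq nat) : bool :=
  all (fun v => nth 0 s (nth 0 g v) == nth 0 s v) varieties.

Definition widest (lo hi : seq nat) : nat :=
  foldl (fun u v => if nth 0 hi u - nth 0 lo u < nth 0 hi v - nth 0 lo v
                    then v else u) 0 varieties.

Definition raise_bound (v c : nat) (lo : seq nat) : seq nat :=
  tabulate (fun u => if u == v then c else nth 0 lo u).

Definition lower_bounds (vs : seq nat) (c : nat) (hi : seq nat) : seq nat :=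
  tabulate (fun u => if u \in vs then minn (nth 0 hi u) c else nth 0 hi u).

Definition link_cubes (v k : nat) (forests : seq (seq (seq nat))) :
    seq (seq (seq nat)) :=
  tabulate (fun t => add_edges (links t) (nseq k v) (nth [::] forests t)).

Definition box_search : Type :=
  seq (seq nat) -> seq nat -> seq nat -> seq (seq (seq nat)) -> bool.

(* The box is split at the weight of variety v; by symmetry under the
   recolorings that preserve the box, the case where v is heavy covers its whole
   orbit. *)
Definition branch (rec : box_search) : box_search := fun G lo hi forests =>
  let G' := [seq g <- G | fixes lo g && fixes hi g] in
  let v := widest lo hi in
  let c := nth 0 lo v + uphalf (nth 0 hi v - nth 0 lo v) in
  [&& v < 30,
      rec G' (raise_bound v c lo) hi (link_cubes v (c - nth 0 lo v) forests) &
      rec G' lo (lower_bounds [seq nth 0 g v | g <- G'] c.-1 hi) forests].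

Fixpoint search (fuel : nat) : box_search := fun G lo hi forests =>
  if fuel is fuel'.+1 then
    if settled lo forests then true else
    let hi' := prune lo hi forests in
    if sumn hi' < 32 then true else branch (search fuel') G lo hi' forests
  else false.

Definition sound_search (rec : box_search) : Prop := forall G lo hi forests m,
  {in G, forall g, variety_symmetry g} -> forests_bound lo forests ->
  rec G lo hi forests -> in_box lo hi m -> 32 <= weight m setT -> fillable m.

Lemma forests_bound_link_cubes lo forests (v : variety) c :
  nth 0 lo v <= c -> forests_bound lo forests ->
  forests_bound (raise_bound v c lo) (link_cubes v (c - nth 0 lo v) forests).
Proof.
move=> le_c bound t; rewrite nth_tabulate -(map_nseq _ val).
apply: tree_bound_mono (corner_tree_bound_add_edges _ (bound t)) => u.
rewrite nth_tabulate count_nseq /= val_eqE; have [->|uv] := eqVneq u v.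
  by rewrite mul1n subnKC.
by rewrite addn0.
Qed.

Lemma prune_in_box lo hi forests m : forests_bound lo forests -> in_box lo hi m ->
  fillable m \/ in_box lo (prune lo hi forests) m.
Proof.
move=> bound box.
case: (boolP [forall v : variety, m v <= nth 0 (prune lo hi forests) v]).
  by move/forallP=> le_m; right=> v; rewrite le_m andbT; case/andP: (box v).
rewrite negb_forall => /existsP[v]; rewrite nth_tabulate -ltnNge => lt_v; left.
move: lt_v; case: hasP => [[t] | _ lt_v].
  rewrite mem_filter mem_iota => /andP[_ lt_t] le_t lt_v; pose t' := Ordinal lt_t.
  exists t'; apply: tree_bound_fillable
    (corner_tree_bound_add_edges [:: v] (bound t')) _ => [u|].
    rewrite /= addn0; have [<-|_] := eqVneq v u; first by rewrite addn1.
    by rewrite addn0; case/andP: (box u).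
  by apply: leq_trans le_t _; case/andP: (box t').
exists v; apply: tree_bound_fillable (bound v) _ => [u|]; first by case/andP: (box u).
by case/andP: (box v) => _; lia.
Qed.

Lemma branch_sound rec : sound_search rec -> sound_search (branch rec).
Proof.
move=> sound_rec G lo hi forests m GP bound; rewrite /branch.
set G' := filter _ G; move: (widest lo hi) => v; case/and3P=> lt_v.
rewrite -[v]/(val (Ordinal lt_v)); move: (Ordinal lt_v) => {lt_v}v.
set c := _ + uphalf _ => heavy light box sum_m.
have {}GP : {in G', forall g, variety_symmetry g}.
  by move=> g; rewrite mem_filter => /andP[_ /GP].
case: (boolP (has (fun g => c <= m (inord (nth 0 g v))) G')) =>
    [/hasP[g G'g] | light_orbit].
  have [_ [p gE pP]] := GP g G'g; rewrite gE inord_val => heavy_g.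
  apply: pP; apply: sound_rec GP (forests_bound_link_cubes _ bound) heavy _ _.
  - by rewrite leq_addr.
  - move: G'g; rewrite mem_filter => /andP[/andP[]] /all_iota_ord fixes_lo.
    move=> /all_iota_ord fixes_hi _ u.
    rewrite nth_tabulate -(eqP (fixes_hi u)) gE /= val_eqE.
    have /andP[lo_u ->] := box (p u); rewrite andbT.
    by case: eqP => [-> //|_]; rewrite -(eqP (fixes_lo u)) gE.
  - by rewrite -[setT](preimsetT p) weight_reindex //; apply: perm_inj.
apply: sound_rec GP bound light _ sum_m => u; have /andP[lo_u hi_u] := box u.
rewrite lo_u nth_tabulate; case: mapP => // -[g G'g eq_u].
rewrite leq_min hi_u; have := hasPn light_orbit g G'g.
by rewrite -eq_u inord_val -ltnNge; lia.
Qed.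

Lemma searchS fuel G lo hi forests : search fuel.+1 G lo hi forests =
  if settled lo forests then true else
  if sumn (prune lo hi forests) < 32 then true else
  branch (search fuel) G lo (prune lo hi forests) forests.
Proof. by []. Qed.

Lemma search_sound fuel : sound_search (search fuel).
Proof.
elim: fuel => // fuel IHfuel G lo hi forests m GP bound found box sum_m.
move: found; rewrite searchS; case: ifP => [/hasP[t] | _].
  rewrite mem_iota => lt_t le_t _; exists (Ordinal lt_t).
  apply: tree_bound_fillable (bound (Ordinal lt_t)) _ => [v|].
    by case/andP: (box v).
  by apply: leq_trans le_t _; case/andP: (box (Ordinal lt_t)).
have [//|pruned] := prune_in_box bound box; case: ifP => [lt32 _ | _ found].
  move: sum_m; rewrite leqNgt (leq_ltn_trans _ lt32) // sumn_tabulate /weight.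
  rewrite big_mkcond; apply: leq_sum => v _.
  by rewrite inE; have /andP[_] := pruned v; rewrite nth_tabulate.
exact: (branch_sound IHfuel) found pruned sum_m.
Qed.

Lemma search_succeeds :
  search 40 recolorings (nseq 30 0) (nseq 30 7) (nseq 30 (isolated (iota 0 8))).
Proof. vm_cast_no_check (erefl true). Qed.

Lemma fillable_of_weight (m : variety -> nat) : 32 <= weight m setT -> fillable m.
Proof.
move=> le32; case: (boolP [exists v, 8 <= m v]) => [/existsP[v le8]|].
  by exists v; apply: heavy_fillable.
rewrite negb_exists => /forallP lt8.
apply: search_sound recolorings_symmetry _ search_succeeds _ le32 => v.
  by rewrite nth_nseq ltn_ord; apply: tree_bound_isolated.
by rewrite !nth_nseq ltn_ord /= leqNgt lt8.
Qed.

(** * Opposite colors *)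

Definition opp_color (l : seq nat) (a : nat) : nat :=
  let i := index a l in nth 0 l (if odd i then i.-1 else i.+1).

Definition opp (v : variety) : {ffun color -> color} :=
  [ffun a : color => inord (opp_color (rep v) a)].

Lemma opp_color_rep (v : variety) (a : color) :
  [&& opp_color (rep v) a < 6, opp_color (rep v) a != a &
      opp_color (rep v) (opp_color (rep v) a) == a].
Proof.
have /all2_iota_ord/(_ v a) // : all (fun v => all (fun a =>
  [&& opp_color (rep v) a < 6, opp_color (rep v) a != a &
      opp_color (rep v) (opp_color (rep v) a) == a]) (iota 0 6)) varieties.
by vm_compute.
Qed.

Lemma oppE v a : opp v a = opp_color (rep v) a :> nat.
Proof. by rewrite ffunE inordK; case/and3P: (opp_color_rep v a). Qed.

Lemma opp_neq v a : opp v a != a.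
Proof. by rewrite -val_eqE /= oppE; case/and3P: (opp_color_rep v a). Qed.

Lemma oppK v : involutive (opp v).
Proof.
by move=> a; apply: ord_inj; rewrite !oppE; apply/eqP; case/and3P: (opp_color_rep v a).
Qed.

Lemma eq_opp_two v w a b :
  opp v a = opp w a -> opp v b = opp w b -> b != a -> b != opp v a -> opp v = opp w.
Proof.
move=> eq_a eq_b ba b_opp; apply/ffunP.
apply: eq_fixfree_involution6 eq_a eq_b ba b_opp; rewrite ?card_ord //.
- exact: oppK.
- exact: oppK.
- exact: opp_neq.
- exact: opp_neq.
Qed.

Lemma eq_opp (v w : variety) : (opp v == opp w) = (v./2 == w./2 :> nat).
Proof.
pose opps u := [seq opp_color (rep u) a | a <- iota 0 6].
have <- : (opps v == opps w) = (v./2 == w./2).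
  have /all2_iota_ord/(_ v w)/eqP-> // : all (fun v => all (fun w =>
    (opps v == opps w) == (v./2 == w./2)) varieties) varieties by vm_compute.
apply/eqP/eqP => [eq_vw | /eq_in_map eq_vw].
  apply/eq_in_map => a; rewrite mem_iota => lt_a.
  by rewrite -!(oppE _ (Ordinal lt_a)) eq_vw.
by apply/ffunP => a; apply: val_inj; rewrite /= !oppE eq_vw // mem_iota /=.
Qed.

Definition mates (v : variety) : {set variety} := [set w | opp w == opp v].

Definition pencil (a b : color) : {set variety} := [set v | opp v a == b].

Lemma eq_mates v w : opp v = opp w -> mates v = mates w.
Proof. by rewrite /mates => ->. Qed.

Lemma mates_disjoint v w : opp w != opp v -> [disjoint mates v & mates w].
Proof.
by move=> wv; rewrite disjoint_subset; apply/subsetP => x;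
  rewrite !inE => /eqP ->; rewrite eq_sym.
Qed.

Lemma mates_disjoint_pencil v a b : opp v a != b -> [disjoint mates v & pencil a b].
Proof.
by move=> ab; rewrite disjoint_subset; apply/subsetP => w; rewrite !inE => /eqP->.
Qed.

Lemma card_mates v : #|mates v| <= 2.
Proof.
have <- : #|[set odd (w : variety) | w in mates v]| = #|mates v|.
  apply: card_in_imset => w w'; rewrite !inE !eq_opp => /eqP half_w /eqP half_w' odd_w.
  by apply: val_inj; rewrite /= -[LHS]odd_double_half -[RHS]odd_double_half odd_w
    half_w half_w'.
by rewrite (leq_trans (max_card _)) ?card_bool.
Qed.

Lemma exists_heavier_mate m v :
  exists2 w, opp w = opp v & weight m (mates v) <= 2 * m w.
Proof.
have [|w] := @exists_heaviest _ m (mates v) v; first by rewrite inE.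
rewrite inE => /eqP ? le_w; exists w => //; apply: leq_trans le_w _.
by rewrite leq_mul2r card_mates orbT.
Qed.

(* With k = n - 2, Hall's condition for a frame of variety t: the cubes that
   fit on none of f given edges number at most (12 - f) k.  Such cubes exist
   only for f <= 3, and for f >= 2 they have the same opposite colors. *)
Definition good_target (k : nat) (m : variety -> nat) (t : variety) : Prop :=
  [/\ corners_fillable m t,
      forall a b, opp t a != b -> weight m (pencil a b) <= 11 * k &
      forall v, opp v != opp t -> weight m (mates v) <= 9 * k].

Lemma heavy_mates_good k m v : 1 < k -> weight m setT = 12 * k + 8 ->
  9 * k < weight m (mates v) -> exists t, good_target k m t.
Proof.
move=> k_gt1 total heavy; have [t tv le_t] := exists_heavier_mate m v.
rewrite -(eq_mates tv) in heavy le_t.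
have light (A : {set variety}) : [disjoint mates t & A] -> weight m A <= 3 * k + 7.
  by move/(weight_disjoint m); rewrite total; lia.
exists t; split; first by apply: heavy_fillable; lia.
- move=> a b /(mates_disjoint_pencil (b := b))/light le_w.
  by apply: leq_trans le_w _; lia.
- by move=> w /mates_disjoint/light le_w; apply: leq_trans le_w _; lia.
Qed.

Definition rivals (t a : nat) : seq nat :=
  [seq u <- varieties | (opp_color (rep u) a == opp_color (rep t) a) && (u./2 != t./2)].

Lemma mem_rivals (t u : variety) (a : color) :
  (u : nat) \in rivals t a = (opp u a == opp t a) && (opp u != opp t).
Proof. by rewrite mem_filter mem_iota ltn_ord !andbT -!val_eqE /= !oppE eq_opp. Qed.

(* Two copies of a rival u close a cycle on the two corners that it shares with
   t; rivals that are not mates use different corners. *)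
Lemma rival_fillable m (t u : variety) (a : color) :
  (u : nat) \in rivals t a -> 2 <= m u -> 6 <= m t -> corners_fillable m t.
Proof.
move=> tu le_u le_t.
have /all_iota_ord/(_ t)/all_iota_ord/(_ a)/allP/(_ _ tu) le6 :
  all (fun t => all (fun a => all (fun u =>
    size (add_edges (links t) [:: u; u] (isolated (iota 0 8))) <= 6)
    (rivals t a)) (iota 0 6)) varieties by vm_compute.
apply: (@cubes_fillable _ _ [:: u; u]) => [w|].
  by rewrite /=; case: eqP => [<-|].
exact: leq_trans le6 le_t.
Qed.

Lemma two_rivals_fillable m (t u v : variety) (a : color) :
  (u : nat) \in rivals t a -> (v : nat) \in rivals t a -> opp u != opp v ->
  2 <= m u -> 2 <= m v -> 4 <= m t -> corners_fillable m t.
Proof.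
move=> tu tv; rewrite eq_opp => uv le_u le_v le_t.
have /all_iota_ord/(_ t)/all_iota_ord/(_ a)/allP/(_ _ tu)/allP/(_ _ tv) :
  all (fun t => all (fun a => all (fun u => all (fun v => (u./2 != v./2) ==>
    (size (add_edges (links t) [:: u; u; v; v] (isolated (iota 0 8))) <= 4))
    (rivals t a)) (rivals t a)) (iota 0 6)) varieties by vm_compute.
rewrite uv => le4; apply: (@cubes_fillable _ _ [:: u; u; v; v]) => [w|].
  rewrite /= !addnA; have [<-|_] := eqVneq u w; last by case: eqP => [<-|].
  by have [vu|_] := eqVneq v u; first by rewrite vu eqxx in uv.
exact: leq_trans le4 le_t.
Qed.

Lemma pencil_cover (t : variety) (a : color) : exists u v : variety,
  [/\ (u : nat) \in rivals t a, (v : nat) \in rivals t a, opp u != opp v &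
      pencil a (opp t a) \subset mates t :|: mates u :|: mates v].
Proof.
have /all_iota_ord/(_ t)/all_iota_ord/(_ a)/hasP[u tu /hasP[v tv]] :
  all (fun t => all (fun a => has (fun u => has (fun v => (u./2 != v./2) &&
    all (fun w => (w./2 == u./2) || (w./2 == v./2)) (rivals t a))
    (rivals t a)) (rivals t a)) (iota 0 6)) varieties by vm_compute.
case/andP=> uv /allP cover.
have lt30 w : w \in rivals t a -> w < 30 by rewrite mem_filter mem_iota => /andP[].
exists (Ordinal (lt30 u tu)), (Ordinal (lt30 v tv)); split; rewrite ?eq_opp //.
apply/subsetP => w; rewrite !inE => wa; case: (eqVneq (opp w) (opp t)) => //= wt.
by rewrite !eq_opp; apply: cover; rewrite mem_rivals wa.
Qed.

Lemma pencil_fillable m (t : variety) (a : color) : weight m (mates t) <= 2 * m t ->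
  {in pencil a (opp t a), forall v, weight m (mates v) <= weight m (mates t)} ->
  22 < weight m (pencil a (opp t a)) -> corners_fillable m t.
Proof.
move=> le_t max_t heavy; have [u0 [v0 [tu0 tv0 uv0 cover]]] := pencil_cover t a.
have [u opp_u le_u] := exists_heavier_mate m u0.
have [v opp_v le_v] := exists_heavier_mate m v0.
have tu : (u : nat) \in rivals t a by move: tu0; rewrite !mem_rivals opp_u.
have tv : (v : nat) \in rivals t a by move: tv0; rewrite !mem_rivals opp_v.
have uv : opp u != opp v by rewrite opp_u opp_v.
have max_u : weight m (mates u0) <= weight m (mates t).
  by apply: max_t; move: tu0; rewrite mem_rivals inE => /andP[].
have max_v : weight m (mates v0) <= weight m (mates t).
  by apply: max_t; move: tv0; rewrite mem_rivals inE => /andP[].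
have {cover} sum3 := leq_trans (weightS m cover) (leq_trans (weightU m _ _)
  (leq_add (weightU m _ _) (leqnn _))).
have [le8|lt8] := leqP 8 (m t); first exact: heavy_fillable.
have [le6|lt6] := leqP 6 (m t).
  have [le2|lt2] := leqP 2 (m u); first exact: rival_fillable tu le2 le6.
  by apply: rival_fillable tv _ le6; lia.
by apply: two_rivals_fillable tu tv uv _ _ _; lia.
Qed.

Lemma other_pencil_light m (t : variety) (a c d : color) :
  {in pencil a (opp t a), forall v, weight m (mates v) <= weight m (mates t)} ->
  opp t c != d ->
  2 * weight m (pencil c d) + weight m (pencil a (opp t a)) <= 2 * weight m setT.
Proof.
set P := pencil a _; set Q := pencil c d => max_t cd.
have t_P : mates t \subset P by apply/subsetP => w; rewrite !inE => /eqP->.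
have t_Q : [disjoint mates t & Q] by apply: mates_disjoint_pencil.
have PQ_t : weight m (P :&: Q) <= weight m (mates t).
  have [->|[w PQw]] := set_0Vmem (P :&: Q); first by rewrite weight0.
  have [Pw Qw] : opp w a = opp t a /\ opp w c = d.
    by move: PQw; rewrite !inE => /andP[/eqP ? /eqP].
  apply: leq_trans (max_t w _); last by rewrite inE Pw.
  apply/weightS/subsetP => x; rewrite !inE => /andP[/eqP Px /eqP Qx].
  apply/eqP; apply: (@eq_opp_two _ _ a c); rewrite ?Px ?Qx //.
    by apply: contra cd => /eqP ca; rewrite -Qw ca Pw.
  by apply: contra cd => /eqP cb; rewrite -Qw cb oppK -Pw oppK.
have := weightID m P Q; have := weightID m Q P; rewrite setIC => eqQ eqP.
have : weight m (mates t) <= weight m (P :\: Q) by rewrite weightS // subsetD t_P.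
have : [disjoint P & Q :\: P] by rewrite disjoints_subset setCD subsetUr.
by move/(weight_disjoint m); lia.
Qed.

Lemma heavy_pencil_good k m a b : 1 < k -> weight m setT = 12 * k + 8 ->
  (forall v, weight m (mates v) <= 9 * k) -> 11 * k < weight m (pencil a b) ->
  exists t, good_target k m t.
Proof.
move=> k_gt1 total light_mates heavy.
have [pencil0|[v0 v0_ab]] := set_0Vmem (pencil a b).
  by rewrite pencil0 weight0 in heavy.
have [v v_ab max_v] : exists2 v, v \in pencil a b &
    {in pencil a b, forall w, weight m (mates w) <= weight m (mates v)}.
  by have [v v_ab max_v] := arg_maxnP (fun v => weight m (mates v)) v0_ab; exists v.
have [t opp_t le_t] := exists_heavier_mate m v.
have eq_b : b = opp t a by move: v_ab; rewrite inE opp_t => /eqP.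
rewrite -(eq_mates opp_t) in max_v le_t; rewrite eq_b in heavy max_v.
exists t; split=> //; first by apply: pencil_fillable le_t max_v _; lia.
move=> c d cd; move: heavy (other_pencil_light max_v cd); rewrite total.
by move: (weight m _) (weight m _) => p q; lia.
Qed.

Theorem exists_good_target k m : 1 < k -> weight m setT = 12 * k + 8 ->
  exists t, good_target k m t.
Proof.
move=> k_gt1 total.
case: (boolP [exists v, 9 * k < weight m (mates v)]) => [/existsP[v]|].
  exact: heavy_mates_good.
rewrite negb_exists => /forallP light_mates.
have {}light_mates v : weight m (mates v) <= 9 * k by rewrite leqNgt light_mates.
case: (boolP [exists a, [exists b, 11 * k < weight m (pencil a b)]]).
  by case/existsP=> a /existsP[b]; apply: heavy_pencil_good.
rewrite negb_exists => /forallP light_pencils.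
have [|t mt] := @fillable_of_weight m; first by rewrite total; lia.
exists t; split=> // a b _; rewrite leqNgt.
by have := light_pencils a; rewrite negb_exists => /forallP.
Qed.

(** * Turning cubes *)

Definition axis0 : 'I_3 := @Ordinal 3 0 isT.
Definition axis1 : 'I_3 := @Ordinal 3 1 isT.
Definition axis2 : 'I_3 := @Ordinal 3 2 isT.

Lemma axisP (P : 'I_3 -> Prop) : P axis0 -> P axis1 -> P axis2 -> forall i, P i.
Proof.
move=> P0 P1 P2 [[|[|[|//]]] lt]; [move: P0 | move: P1 | move: P2];
  by congr P; apply: val_inj.
Qed.

Lemma big_axes (F : 'I_3 -> bool) :
  \big[addb/false]_i F i = F axis0 (+) F axis1 (+) F axis2.
Proof.
rewrite !big_ord_recl big_ord0 addbF addbA.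
by congr (F _ (+) F _ (+) F _); apply: val_inj.
Qed.

Lemma ordS_neq (i : 'I_3) :
  [/\ ordS i != i, ordS (ordS i) != i & ordS (ordS i) != ordS i].
Proof. by move: i; apply: axisP. Qed.

Lemma ordS3 (i : 'I_3) : ordS (ordS (ordS i)) = i.
Proof. by move: i; apply: axisP; apply: val_inj. Qed.

Lemma ordS_cover (a i : 'I_3) : [|| i == a, i == ordS a | i == ordS (ordS a)].
Proof. by move: a i; apply: axisP; apply: axisP. Qed.

Definition axis_cycle : 'S_3 := perm (@ordS_inj 3).

Lemma axis_cycle_even : odd_perm axis_cycle = false.
Proof.
have : (axis_cycle * axis_cycle * axis_cycle)%g = 1%g.
  by apply/permP => i; rewrite !permM !permE ordS3.
by move/(congr1 (@odd_perm _)); rewrite !odd_permM odd_perm1 addbb.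
Qed.

Lemma exists_perm3 (i j : 'I_3) : i != j ->
  exists p : 'S_3, p axis0 = i /\ p axis1 = j.
Proof.
move=> ij; set u := tperm axis0 i axis1.
have ui : u != i by rewrite -(inj_eq (@perm_inj _ (tperm axis0 i))) tpermK tpermR.
exists (tperm axis0 i * tperm u j)%g; rewrite !permM tpermL -/u tpermL.
by rewrite tpermD // eq_sym.
Qed.

Lemma move_face_inj r : injective (move_face r).
Proof. by move=> [i b] [j b'] [/perm_inj/= -> /addIb ->]. Qed.

Lemma face_color_onto (x : cube) a : exists f, face_color x f = a.
Proof. by have /forallP/(_ a)/existsP[f /eqP] := valP x; exists f. Qed.

Lemma card_face : #|{: face}| = 6.
Proof. by rewrite card_prod card_ord card_bool. Qed.

Lemma face_color_inj (x : cube) : injective (face_color x).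
Proof.
apply/injectiveP/card_uniqP; rewrite size_map -cardE card_face -[RHS](card_ord 6).
by apply: eq_card => a; have [f <-] := face_color_onto x a; rewrite codom_f.
Qed.

Lemma exists_cube (g : face -> color) : injective g -> exists x : cube,
  forall f, face_color x f = g f.
Proof.
move=> g_inj; have g_onto : [forall a : color, exists f, finfun g f == a].
  apply/forallP=> a; have /codomP[f ->] : a \in codom g.
    by apply: inj_card_onto; rewrite // card_face card_ord.
  by apply/existsP; exists f; rewrite ffunE.
by exists (exist _ (finfun g) g_onto) => f; rewrite /face_color ffunE.
Qed.

Lemma turn_cube (x : cube) r : rotation r -> exists y : cube,
  same_variety x y /\ forall f, face_color y (move_face r f) = face_color x f.
Proof.
move=> rot_r; have inv_inj : injective (invF (@move_face_inj r)).
  exact: can_inj (f_invF _).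
have [y yE] := exists_cube (inj_comp (@face_color_inj x) inv_inj).
have {}yE f : face_color y (move_face r f) = face_color x f by rewrite yE /= invF_f.
by exists y; split=> //; apply/existsP; exists r; rewrite rot_r; apply/forallP => f;
  rewrite yE.
Qed.

(* The signed permutation matrix that takes the faces (p i, e i) to the faces
   (q i, d i) is a rotation when the parities agree. *)
Lemma turn_flag (x : cube) (p q : 'S_3) (e d : 'I_3 -> bool) :
  odd_perm p (+) \big[addb/false]_i e i = odd_perm q (+) \big[addb/false]_i d i ->
  exists y : cube, same_variety x y /\
    forall i, face_color y (q i, d i) = face_color x (p i, e i).
Proof.
move=> eq_parity.
pose r : symmetry :=
  ((p^-1 * q)%g, [ffun j => e ((p^-1)%g j) (+) d ((p^-1)%g j)]).
have rot_r : rotation r.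
  rewrite /rotation /r /= odd_permM odd_permV (reindex_inj (@perm_inj _ p)) /=.
  under eq_bigr => i _ do rewrite ffunE permK.
  by rewrite big_split /= addbACA eq_parity addbb.
have [y [xy yE]] := turn_cube x rot_r; exists y; split=> // i.
by rewrite -yE /move_face /r /= ffunE permM !permK addbA addbb addFb.
Qed.

Lemma turn_two_faces (x : cube) (f f' d d' : face) : f.1 != f'.1 -> d.1 != d'.1 ->
  exists y : cube, [/\ same_variety x y, face_color y d = face_color x f &
    face_color y d' = face_color x f'].
Proof.
move=> ff' dd'; have [p [p0 p1]] := exists_perm3 ff'.
have [q [q0 q1]] := exists_perm3 dd'.
pose triple b0 b1 b2 (i : 'I_3) : bool :=
  if i == axis0 then b0 else if i == axis1 then b1 else b2.
pose b := odd_perm p (+) odd_perm q (+) f.2 (+) f'.2 (+) d.2 (+) d'.2.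
have [|y [xy yE]] := @turn_flag x p q (triple f.2 f'.2 false) (triple d.2 d'.2 b).
  rewrite !big_axes /triple /= /b; move: (odd_perm p) (odd_perm q) f.2 f'.2 d.2 d'.2.
  by do 6!case.
exists y; split=> //.
  by have := yE axis0; rewrite p0 q0 /triple /= -!surjective_pairing.
by have := yE axis1; rewrite p1 q1 /triple /= -!surjective_pairing.
Qed.

(** * Cubes as lists of colors *)

Definition faces : seq face :=
  [:: (axis0, false); (axis0, true); (axis1, false); (axis1, true);
      (axis2, false); (axis2, true)].

Definition face_index (f : face) : nat := f.1.*2 + f.2.

Definition color_list (x : cube) : seq nat :=
  [seq nat_of_ord (face_color x f) | f <- faces].

Lemma face_index_faces : [seq face_index f | f <- faces] = iota 0 6.
Proof. by []. Qed.

Lemma face_index_inj : injective face_index.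
Proof.
move=> [i b] [j c] /eqP.
by move: i j; apply: axisP; apply: axisP; case: b; case: c.
Qed.

Lemma nth_color_list x f : nth 0 (color_list x) (face_index f) = face_color x f.
Proof. by case: f => i b; move: i; apply: axisP; case: b. Qed.

Lemma face_index_lt f : face_index f < 6.
Proof. by case: f => i b; move: i; apply: axisP; case: b. Qed.

Lemma color_list_perm x : perm_eq (color_list x) (iota 0 6).
Proof.
have uniq_l : uniq (color_list x).
  by rewrite map_inj_uniq // => f g /ord_inj/face_color_inj.
have sub_l : {subset color_list x <= iota 0 6}.
  by move=> a /mapP[f _ ->]; rewrite mem_iota /=.
by have [] := uniq_min_size uniq_l sub_l (leqnn 6) => _; apply: uniq_perm.
Qed.

Lemma exists_cube_of_list l : perm_eq l (iota 0 6) -> exists x, color_list x = l.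
Proof.
move=> l_perm; have size_l : size l = 6 by rewrite (perm_size l_perm).
have lt6 f : nth 0 l (face_index f) < 6.
  have : nth 0 l (face_index f) \in l by rewrite mem_nth // size_l face_index_lt.
  by rewrite (perm_mem l_perm) mem_iota.
have [|x xE] := @exists_cube (fun f => Ordinal (lt6 f)).
  move=> f g [] /eqP; rewrite nth_uniq ?size_l ?face_index_lt //.
    by move/eqP/face_index_inj.
  by rewrite (perm_uniq l_perm).
exists x; rewrite /color_list (eq_map (fun f => congr1 val (xE f))) /=.
by rewrite -[RHS](mkseq_nth 0) size_l /mkseq -face_index_faces -map_comp.
Qed.

Definition variety_of (x : cube) : variety := inord (variety_index (color_list x)).

Lemma variety_of_spec x :
  perm_eq (corners_of (color_list x)) (corners (variety_of x)) /\
  forall a : color, opp_color (color_list x) a = opp (variety_of x) a.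
Proof.
have /allP/(_ (color_list x)) : all (fun l => let v := variety_index l in
    [&& v < 30, perm_eq (corners_of l) (corners v) &
        all (fun a => opp_color l a == opp_color (rep v) a) (iota 0 6)])
    (permutations (iota 0 6)) by vm_compute.
rewrite mem_permutations color_list_perm => /(_ isT)/and3P[lt_v eq_corners].
move=> /all_iota_ord eq_opp; rewrite /variety_of.
by split=> [|a]; rewrite ?oppE inordK //; apply/eqP.
Qed.

Lemma exists_cube_of_variety v : exists x, variety_of x = v.
Proof.
have /all_iota_ord/(_ v)/andP[] : all (fun v => perm_eq (rep v) (iota 0 6) &&
  (variety_index (rep v) == v)) varieties by vm_compute.
move=> /exists_cube_of_list[x xv] /eqP eq_v.
by exists x; rewrite /variety_of xv eq_v inord_val.
Qed.

Lemma opp_face_color x f :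
  opp (variety_of x) (face_color x f) = face_color x (f.1, ~~ f.2).
Proof.
have [_ oppP] := variety_of_spec x; apply: ord_inj; rewrite -oppP.
rewrite /opp_color -nth_color_list index_uniq ?face_index_lt //; last first.
  by rewrite (perm_uniq (color_list_perm x)) iota_uniq.
rewrite -nth_color_list; congr nth; rewrite /face_index oddD odd_double oddb.
by case: f => i [] /=; rewrite ?addn0 ?addn1.
Qed.

Definition cube_corner (x : cube) (e : {ffun 'I_3 -> bool}) : seq nat :=
  corner_at (color_list x) (e axis0) (e axis1) (e axis2).

Lemma cube_corner_mem x e : cube_corner x e \in corners (variety_of x).
Proof.
have [cornersP _] := variety_of_spec x; rewrite -(perm_mem cornersP).
apply/mapP; exists (e axis0, e axis1, e axis2) => //.
by case: (e axis0); case: (e axis1); case: (e axis2).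
Qed.

Lemma mem_corners_variety x k :
  k \in corners (variety_of x) -> exists e, k = cube_corner x e.
Proof.
have [cornersP _] := variety_of_spec x; rewrite -(perm_mem cornersP).
case/mapP=> -[[b0 b1] b2] _ ->.
exists [ffun i : 'I_3 => if i == axis0 then b0 else if i == axis1 then b1 else b2].
by rewrite /cube_corner !ffunE.
Qed.

Lemma cube_corner_inj x : injective (cube_corner x).
Proof.
have [cornersP _] := variety_of_spec x.
have inj : injective (fun s : bool * bool * bool =>
    corner_at (color_list x) s.1.1 s.1.2 s.2).
  apply/injectiveP; rewrite /injectiveb /dinjectiveb.
  rewrite (perm_uniq (perm_map _ (_ : perm_eq _ signs))).
    by rewrite -/(corners_of _) (perm_uniq cornersP) corners_uniq.
  by apply: uniq_perm; rewrite ?enum_uniq // => -[[[] []] []]; rewrite mem_enum.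
move=> e d /(inj (e axis0, e axis1, e axis2) (d axis0, d axis1, d axis2)) [e0 e1 e2].
by apply/ffunP; apply: axisP.
Qed.

Lemma oriented_corner_rot a b c a' b' c' :
  oriented_corner a b c = oriented_corner a' b' c' ->
  [\/ [/\ a = a', b = b' & c = c'], [/\ a = b', b = c' & c = a'] |
      [/\ a = c', b = a' & c = b']].
Proof.
rewrite /oriented_corner.
case: ifP => _; [|case: ifP => _]; (case: ifP => _; [|case: ifP => _]).
all: by move=> [-> -> ->]; constructor.
Qed.

Lemma eq_oriented_corner (f g : 'I_3 -> nat) :
  oriented_corner (f axis0) (f axis1) (f axis2) =
  oriented_corner (g axis0) (g axis1) (g axis2) ->
  exists s : 'S_3, odd_perm s = false /\ forall i, f i = g (s i).
Proof.
have rot1 i : axis_cycle i = ordS i by rewrite permE.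
have rot2 i : (axis_cycle * axis_cycle)%g i = ordS (ordS i) by rewrite permM !permE.
have S0 : ordS axis0 = axis1 by apply: val_inj.
have S1 : ordS axis1 = axis2 by apply: val_inj.
have S2 : ordS axis2 = axis0 by apply: val_inj.
case/oriented_corner_rot=> -[f0 f1 f2].
- by exists 1%g; rewrite odd_perm1; split=> //; apply: axisP; rewrite perm1.
- exists axis_cycle; rewrite axis_cycle_even; split=> //.
  by apply: axisP; rewrite rot1 ?S0 ?S1 ?S2.
- exists (axis_cycle * axis_cycle)%g; rewrite odd_permM axis_cycle_even; split=> //.
  by apply: axisP; rewrite rot2 ?S0 ?S1 ?S2 ?S0 ?S1 ?S2.
Qed.

(* The order in which the axes at the corner with signs e are listed in positive
   orientation. *)
Definition corner_axes (e : {ffun 'I_3 -> bool}) : 'S_3 :=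
  if \big[addb/false]_i e i then 1%g else tperm axis0 axis1.

Definition corner_face (e : {ffun 'I_3 -> bool}) (i : 'I_3) : face :=
  (corner_axes e i, e (corner_axes e i)).

Lemma corner_axes_parity e :
  odd_perm (corner_axes e) (+) \big[addb/false]_i e (corner_axes e i) = true.
Proof.
have <- : \big[addb/false]_i e i = \big[addb/false]_i e (corner_axes e i).
  by rewrite [LHS](reindex_inj (@perm_inj _ (corner_axes e))).
by rewrite /corner_axes; case: ifP => _; rewrite ?odd_perm1 // odd_tperm.
Qed.

Definition corner_color (x : cube) (e : {ffun 'I_3 -> bool}) (i : 'I_3) : nat :=
  face_color x (corner_face e i).

Lemma cube_cornerE x e : cube_corner x e =
  oriented_corner (corner_color x e axis0) (corner_color x e axis1)
    (corner_color x e axis2).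
Proof.
rewrite /corner_color /corner_face /cube_corner /corner_at.
rewrite -[nth 0 _ (e axis0)]/(nth 0 _ (face_index (axis0, e axis0))).
rewrite -[nth 0 _ (e axis1).+2]/(nth 0 _ (face_index (axis1, e axis1))).
rewrite -[nth 0 _ (e axis2).+4]/(nth 0 _ (face_index (axis2, e axis2))).
rewrite !nth_color_list /corner_axes big_axes.
by case: ifP => _ /=; rewrite ?perm1 // tpermL tpermR tpermD.
Qed.

Lemma turn_corner (x t : cube) (e : {ffun 'I_3 -> bool}) :
  cube_corner t e \in corners (variety_of x) -> exists y : cube,
    same_variety x y /\ forall i, face_color y (i, e i) = face_color t (i, e i).
Proof.
case/mem_corners_variety=> d; rewrite !cube_cornerE.
case/eq_oriented_corner=> s [s_even sE].
have [|y [xy yE]] := @turn_flag x (s * corner_axes d)%g (corner_axes e)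
    (fun i => d (corner_axes d (s i))) (fun i => e (corner_axes e i)).
  rewrite corner_axes_parity odd_permM s_even addFb -[RHS](corner_axes_parity d).
  by congr (_ (+) _); rewrite [RHS](reindex_inj (@perm_inj _ s)).
exists y; split=> // i; have := yE ((corner_axes e)^-1 i)%g.
have := ord_inj (sE ((corner_axes e)^-1 i)%g).
by rewrite /corner_face permM permKV => ->.
Qed.

Definition fits (x t : cube) (D : {set face}) : bool :=
  [exists y : cube, same_variety x y &&
    [forall d in D, face_color y d == face_color t d]].

Lemma fits_edge x t (d d' : face) : d.1 != d'.1 ->
  opp (variety_of x) (face_color t d) != face_color t d' -> fits x t [set d; d'].
Proof.
move=> dd' not_opp; have [f fE] := face_color_onto x (face_color t d).
have [f' fE'] := face_color_onto x (face_color t d').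
have ff' : f.1 != f'.1.
  apply: contra not_opp => /eqP ff'; rewrite -fE -fE' opp_face_color ff'.
  rewrite [f' in eqbRHS]surjective_pairing.
  case: (eqVneq f'.2 (~~ f.2)) => [->//|f2].
  case/eqP: dd'; congr fst; apply: (@face_color_inj t); rewrite -fE -fE'.
  rewrite [f]surjective_pairing [f']surjective_pairing ff'.
  by move: f2; case: f.2; case: f'.2.
have [y [xy yd yd']] := turn_two_faces x ff' dd'.
apply/existsP; exists y; rewrite xy; apply/forall_inP => g.
by rewrite !inE => /orP[] /eqP ->; rewrite ?yd ?yd' ?fE ?fE'.
Qed.

Lemma fits_corner x t e : cube_corner t e \in corners (variety_of x) ->
  fits x t [set d | d.2 == e d.1].
Proof.
case/turn_corner=> y [xy yE]; apply/existsP; exists y; rewrite xy.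
by apply/forall_inP=> -[i b]; rewrite inE => /= /eqP ->; rewrite yE.
Qed.

(** * The slots of a frame *)

(* The free axis of an edge, and the signs on the next two axes. *)
Definition cube_edge : Type := ('I_3 * bool * bool)%type.

Definition first_face (E : cube_edge) : face := (ordS E.1.1, E.1.2).
Definition second_face (E : cube_edge) : face := (ordS (ordS E.1.1), E.2).

Definition slot (k : nat) : Type := ({ffun 'I_3 -> bool} + cube_edge * 'I_k)%type.

Definition slot_faces k (z : slot k) : {set face} :=
  match z with
  | inl e => [set d | d.2 == e d.1]
  | inr (E, _) => [set first_face E; second_face E]
  end.

Lemma card_cube_edge : #|{: cube_edge}| = 12.
Proof. by rewrite !card_prod !card_bool !card_ord. Qed.

Lemma card_slot k : #|{: slot k}| = 12 * k + 8.
Proof.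
by rewrite card_sum card_ffun card_prod card_cube_edge card_bool !card_ord addnC.
Qed.

Lemma edge_faces_axis E : (first_face E).1 != (second_face E).1.
Proof. by rewrite eq_sym; case: (ordS_neq E.1.1). Qed.

Lemma edge_faces_inj E E' :
  first_face E = first_face E' -> second_face E = second_face E' -> E = E'.
Proof.
case: E E' => [[a b] c] [[a' b'] c'] /eqP; rewrite xpair_eqE.
case/andP=> /eqP/ordS_inj /= -> /eqP /= -> /eqP; rewrite xpair_eqE.
by case/andP=> _ /eqP /= ->.
Qed.

Lemma edge_faces_cross E E' :
  first_face E = second_face E' -> second_face E <> first_face E'.
Proof.
move=> /(congr1 fst)/= axis_first /(congr1 fst)/= axis_second.
by have [] := ordS_neq E'.1.1; rewrite -axis_second axis_first ordS3 eqxx.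
Qed.

(** * Varieties that clash with edges *)

Section Clash.

Variable t : cube.
Implicit Types (E : cube_edge) (F : {set cube_edge}) (w : variety).

Let first E : color := face_color t (first_face E).
Let second E : color := face_color t (second_face E).

(* A cube fails to fit on an edge iff it has the two colors of the edge on
   opposite faces. *)
Definition clashing F : {set variety} :=
  [set w | [forall E in F, opp w (first E) == second E]].

Lemma clashingP F w E : w \in clashing F -> E \in F -> opp w (first E) = second E.
Proof. by rewrite inE => /forall_inP wF /wF/eqP. Qed.

Lemma opp_first E : opp (variety_of t) (first E) != second E.
Proof.
rewrite opp_face_color (inj_eq (@face_color_inj t)).
by apply: contra (edge_faces_axis E) => /eqP <-.
Qed.

Lemma clashing_first_inj F w : w \in clashing F -> {in F &, injective first}.
Proof.
move=> wF E E' EF E'F eq_first; apply: edge_faces_inj; apply: (@face_color_inj t).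
  exact: eq_first.
by rewrite -/(second E) -(clashingP wF EF) eq_first (clashingP wF E'F).
Qed.

Lemma clashing_first_second F w E E' :
  w \in clashing F -> E \in F -> E' \in F -> first E != second E'.
Proof.
move=> wF EF E'F; apply/eqP => eq_colors.
apply: (@edge_faces_cross E E'); apply: (@face_color_inj t); first exact: eq_colors.
by rewrite -/(second E) -(clashingP wF EF) eq_colors -(clashingP wF E'F) oppK.
Qed.

Lemma card_clash F w : w \in clashing F -> #|F| <= 3.
Proof.
move=> wF; have first_inj := clashing_first_inj wF.
have card_first : #|first @: F| = #|F| by apply: card_in_imset.
have card_second : #|second @: F| = #|F|.
  rewrite -card_first -(card_imset (first @: F) (can_inj (@oppK w))).
  rewrite -imset_comp; congr #|pred_of_set _|; apply: eq_in_imset => E EF /=.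
  by rewrite (clashingP wF EF).
have disj : [disjoint first @: F & second @: F].
  apply/pred0P => a /=; apply/andP => -[/imsetP[E EF ->] /imsetP[E' E'F]].
  exact/eqP/(clashing_first_second wF EF E'F).
have := max_card (first @: F :|: second @: F).
rewrite card_ord (eqP (etrans (leq_card_setU _ _).2 disj)) card_first card_second.
by lia.
Qed.

Lemma clashing_sub_mates F E E' w : E \in F -> E' \in F -> E' != E ->
  w \in clashing F -> clashing F \subset mates w.
Proof.
move=> EF E'F E'E wF; apply/subsetP => v vF; rewrite inE.
apply/eqP; apply: (@eq_opp_two _ _ (first E) (first E')).
- by rewrite (clashingP vF) // (clashingP wF).
- by rewrite (clashingP vF) // (clashingP wF).
- by apply: contra E'E => /eqP/(clashing_first_inj wF E'F EF) ->.
- by rewrite (clashingP vF) //; apply: clashing_first_second wF _ _.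
Qed.

Lemma weight_clashing k m F : good_target k m (variety_of t) -> F != set0 ->
  weight m (clashing F) + #|F| * k <= 12 * k.
Proof.
case=> _ light_pencils light_mates; case/set0Pn=> E EF.
have [->|[w wF]] := set_0Vmem (clashing F).
  by rewrite weight0 add0n leq_mul2r -card_cube_edge max_card orbT.
have le3 := card_clash wF.
case: (boolP (F \subset [set E])) => [FE | /subsetPn[E' E'F]].
  have le1 : #|F| * k <= 1 * k.
    by have := subset_leq_card FE; rewrite cards1 leq_mul2r => ->; rewrite orbT.
  have sub : clashing F \subset pencil (first E) (second E).
    by apply/subsetP => v vF; rewrite inE (clashingP vF).
  by have := leq_trans (weightS m sub) (light_pencils _ _ (opp_first E)); lia.
rewrite inE => E'E; have sub := clashing_sub_mates EF E'F E'E wF.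
have w_t : opp w != opp (variety_of t).
  by apply: contra (opp_first E) => /eqP <-; rewrite (clashingP wF).
have := leq_trans (weightS m sub) (light_mates w w_t).
have : #|F| * k <= 3 * k by rewrite leq_mul2r le3 orbT.
by lia.
Qed.

End Clash.

(** * Placing the cubes *)

Definition variety_count N (c : 'I_N -> cube) (v : variety) : nat :=
  #|(variety_of \o c) @^-1: [set v]|.

Section Placement.

Variables (k N : nat) (c : 'I_N -> cube) (t : cube).
Implicit Types X : {set slot k}.

Definition fitting (z : slot k) : {set 'I_N} :=
  [set i | fits (c i) t (slot_faces z)].

Definition corner_slots X : {set {ffun 'I_3 -> bool}} := [set e | inl e \in X].

Definition slot_edges X : {set cube_edge} := [set E | [exists j, inr (E, j) \in X]].

Lemma card_slots_le X : #|X| <= #|corner_slots X| + #|slot_edges X| * k.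
Proof.
have sX : X \subset [set inl e | e in corner_slots X] :|:
    [set inr z | z in setX (slot_edges X) [set: 'I_k]].
  apply/subsetP => -[e | [E j]] zX; rewrite inE; apply/orP; [left | right].
    by apply: imset_f; rewrite inE.
  by apply: imset_f; rewrite !inE andbT; apply/existsP; exists j.
apply: leq_trans (subset_leq_card sX) (leq_trans (leq_card_setU _ _) _).
rewrite leq_add ?leq_imset_card // (leq_trans (leq_imset_card _ _)) //.
by rewrite cardsX cardsT card_ord.
Qed.

Lemma corner_slots_covered X : corners_fillable (variety_count c) (variety_of t) ->
  #|corner_slots X| <= #|neighbours fitting X|.
Proof.
move=> fillable_t; pose S := [seq cube_corner t e | e <- enum (corner_slots X)].
have -> : #|corner_slots X| = size S by rewrite size_map -cardE.
apply: leq_trans (fillable_t S _ _) _.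
- by rewrite map_inj_uniq ?enum_uniq //; apply: cube_corner_inj.
- by move=> _ /mapP[e _ ->]; apply: cube_corner_mem.
rewrite weight_preim; apply/subset_leq_card/subsetP => i.
rewrite !inE => /hasP[_ /mapP[e eX ->] e_i]; apply/bigcupP; exists (inl e).
  by move: eX; rewrite mem_enum inE.
by rewrite inE fits_corner.
Qed.

Lemma edge_slots_covered X :
  N <= weight (variety_count c) (clashing t (slot_edges X)) + #|neighbours fitting X|.
Proof.
set bad := clashing t _; rewrite weight_preim -[leqLHS]card_ord.
rewrite -(cardsC ((variety_of \o c) @^-1: bad)) leq_add2l.
apply/subset_leq_card/subsetP => i; rewrite !inE negb_forall.
case/existsP=> E; rewrite negb_imply inE => /andP[/existsP[j jX] not_opp].
by apply/bigcupP; exists (inr (E, j)); rewrite // inE fits_edge ?edge_faces_axis.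
Qed.

Lemma hall_condition_slots : N = 12 * k + 8 ->
  good_target k (variety_count c) (variety_of t) -> hall_condition fitting setT.
Proof.
move=> eqN good X _; apply: leq_trans (card_slots_le X) _.
have [F0|F_neq0] := eqVneq (slot_edges X) set0.
  by rewrite F0 cards0 addn0; apply: corner_slots_covered; case: good.
have le8 : #|corner_slots X| <= 8.
  by rewrite (leq_trans (max_card _)) // card_ffun card_bool card_ord.
by have := edge_slots_covered X; have := weight_clashing good F_neq0; lia.
Qed.

End Placement.

Lemma exists_placement k N (c : 'I_N -> cube) : 1 < k -> N = 12 * k + 8 ->
  exists t, exists2 s : slot k -> 'I_N, injective s &
    forall z, fits (c (s z)) t (slot_faces z).
Proof.
move=> k_gt1 eqN; have [|v v_good] := @exists_good_target k (variety_count c) k_gt1.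
  by rewrite weight_preim preimsetT cardsT card_ord.
have [t t_v] := exists_cube_of_variety v; rewrite -t_v in v_good.
have i0 : 'I_N by apply: (@Ordinal N 0); rewrite eqN addn_gt0 orbT.
have [s [s_inj sP]] := hall i0 (hall_condition_slots eqN v_good).
exists t, s => [z z' | z]; first by apply: s_inj; rewrite inE.
by have := sP z; rewrite !inE; apply.
Qed.

(** * Frames *)

Definition slot_position k (z : slot k) : position k.+2 :=
  match z with
  | inl e => [ffun i => if e i then ord_max else ord0]
  | inr (E, j) => [ffun i => if i == E.1.1 then inord j.+1
      else if (if i == ordS E.1.1 then E.1.2 else E.2) then ord_max else ord0]
  end.

Definition extremal k (p : position k.+2) (i : 'I_3) : bool :=
  (p i == 0 :> nat) || (p i == k.+1 :> nat).

Lemma extremal_corner k e i : extremal (slot_position (inl e : slot k)) i.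
Proof. by rewrite /extremal ffunE; case: (e i); rewrite /= ?eqxx ?orbT. Qed.

Lemma slot_position_free k E (j : 'I_k) :
  slot_position (inr (E, j)) E.1.1 = j.+1 :> nat.
Proof. by rewrite ffunE eqxx inordK // !ltnS ltnW. Qed.

Lemma extremal_edge k E (j : 'I_k) i :
  extremal (slot_position (inr (E, j))) i = (i != E.1.1).
Proof.
have [-> | i_neq] := eqVneq i E.1.1.
  by rewrite /extremal slot_position_free eqSS orFb (ltn_eqF (ltn_ord j)).
rewrite /extremal ffunE (negbTE i_neq).
by case: (if i == ordS E.1.1 then E.1.2 else E.2); rewrite /= ?eqxx ?orbT.
Qed.

Lemma on_edgeP k (p : position k.+2) :
  reflect (exists a, forall i, i != a -> extremal p i) (on_edge p).
Proof.
apply: (iffP idP) => [|[a ext]]; last first.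
  have : [set~ a] \subset [set i | extremal p i].
    by apply/subsetP => i; rewrite !inE => /ext.
  by move/subset_leq_card; rewrite cardsC1 card_ord.
case: (pickP (fun a => ~~ extremal p a)) => [a int_a | ext]; last first.
  by exists axis0 => i _; rewrite -[extremal p i]negbK ext.
move=> p_edge; exists a => i ia; apply: contraLR p_edge => int_i.
rewrite /on_edge -ltnNge ltnS.
have : [set i | extremal p i] \subset [set~ a] :\ i.
  apply/subsetP => j; rewrite !inE => ext_j.
  by apply/andP; split; [apply: contraNneq int_i | apply: contraNneq int_a] => <-.
move/subset_leq_card => /leq_trans; apply.
by have := cardsD1 i [set~ a]; rewrite !inE ia cardsC1 card_ord; lia.
Qed.

Lemma slot_position_on_edge k (z : slot k) : on_edge (slot_position z).
Proof.
apply/on_edgeP; case: z => [e | [E j]].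
  by exists axis0 => i _; apply: extremal_corner.
by exists E.1.1 => i; rewrite extremal_edge.
Qed.

Lemma slot_position_inj k : injective (@slot_position k).
Proof.
have end_inj (b b' : bool) : (if b then ord_max else ord0) =
    (if b' then ord_max else ord0) :> 'I_k.+2 -> b = b' by case: b; case: b'.
move=> [e | [E j]] [e' | [E' j']] eq_pos.
- congr inl; apply/ffunP => i; apply: end_inj.
  by have := congr1 (fun p : position _ => p i) eq_pos; rewrite !ffunE.
- by have := extremal_corner k e E'.1.1; rewrite eq_pos extremal_edge eqxx.
- by have := extremal_corner k e' E.1.1; rewrite -eq_pos extremal_edge eqxx.
have axE : E.1.1 = E'.1.1.
  apply/eqP; rewrite -[_ == _]negbK -(extremal_edge E' j') -eq_pos.
  by rewrite extremal_edge eqxx.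
have jj' : j = j'.
  apply/val_inj/succn_inj; rewrite -(slot_position_free E j) eq_pos axE.
  exact: slot_position_free.
have [/negbTE S_neq /negbTE SS_neq /negbTE SS_neqS] := ordS_neq E.1.1.
have := congr1 (fun p : position _ => p (ordS E.1.1)) eq_pos.
have := congr1 (fun p : position _ => p (ordS (ordS E.1.1))) eq_pos.
rewrite !ffunE -axE S_neq SS_neq SS_neqS eqxx => /end_inj sign2 /end_inj sign1.
by rewrite jj' [E]surjective_pairing [E.1]surjective_pairing axE sign1 sign2
  -!surjective_pairing.
Qed.

Lemma slot_position_onto k (p : position k.+2) : on_edge p ->
  exists z, slot_position z = p.
Proof.
have ext_val i : extremal p i ->
    (if p i == k.+1 :> nat then ord_max else ord0) = p i.
  by case/orP=> /eqP e; apply: val_inj; rewrite /= e ?eqxx.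
case/on_edgeP=> a ext; have [ext_a|int_a] := boolP (extremal p a).
  exists (inl [ffun i => p i == k.+1 :> nat]); apply/ffunP => i; rewrite !ffunE.
  by apply: ext_val; have [->|/ext] := eqVneq i a.
have /andP[pa0 pak] : (p a != 0 :> nat) && (p a != k.+1 :> nat) by rewrite -negb_or.
have lt_pa : (p a).-1 < k by have := ltn_ord (p a); lia.
exists (inr ((a, p (ordS a) == k.+1 :> nat, p (ordS (ordS a)) == k.+1 :> nat),
  Ordinal lt_pa)); apply/ffunP => i; rewrite ffunE /=.
have [-> | ia] := eqVneq i a; first by apply: val_inj; rewrite /= inordK; lia.
have := ordS_cover a i; rewrite (negbTE ia) /=.
by case: eqVneq => [<-|_] /= => [_|/eqP <-]; rewrite ext_val ?ext.
Qed.

Definition slot_frame k (z : slot k) : frame k.+2 :=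
  exist _ (slot_position z) (slot_position_on_edge z).

Lemma slot_frame_bij k : bijective (@slot_frame k).
Proof.
have onto (p : frame k.+2) : exists z, slot_frame z == p.
  by have [z zp] := slot_position_onto (valP p); exists z; rewrite -val_eqE /= zp.
exists (fun p => xchoose (onto p)) => [z | p]; last exact/eqP/(xchooseP (onto p)).
by have /(congr1 val)/slot_position_inj := eqP (xchooseP (onto (slot_frame z))).
Qed.

Lemma card_frame k : #|{: frame k.+2}| = 12 * k + 8.
Proof. by rewrite -(bij_eq_card (slot_frame_bij k)) card_slot. Qed.

Lemma outer_face_slot k (z : slot k) d :
  on_outer_face d (slot_position z) -> d \in slot_faces z.
Proof.
rewrite /on_outer_face /=; case: z => [e | [E j]].
  by rewrite ffunE inE; case: (e d.1); case: d.2.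
case: d => i b /=; have [-> | i_neq] := eqVneq i E.1.1.
  rewrite slot_position_free; case: b => //=.
  by rewrite eqSS (ltn_eqF (ltn_ord j)).
rewrite ffunE (negbTE i_neq) !inE /first_face /second_face !xpair_eqE.
have := ordS_cover E.1.1 i; rewrite (negbTE i_neq) /=.
have [_ _ /negbTE SS_neqS] := ordS_neq E.1.1.
case/orP=> /eqP ->; rewrite eqxx ?SS_neqS ?(eq_sym (ordS E.1.1)) ?SS_neqS /= ?orbF.
  by case: E.1.2; case: b.
by case: E.2; case: b.
Qed.

Lemma build_frame k N (c : {ffun 'I_N -> cube}) : 1 < k -> N = 12 * k + 8 ->
  can_build k.+2 c.
Proof.
move=> k_gt1 eqN; have [t [s s_inj sP]] := exists_placement c k_gt1 eqN.
have [slot_of _ frameK] := slot_frame_bij k.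
have /fin_all_exists[q qP] : forall p : frame k.+2, exists y : cube,
    same_variety (c (s (slot_of p))) y /\
    {in slot_faces (slot_of p), forall d, face_color y d = face_color t d}.
  move=> p; have /existsP[y /andP[xy /forall_inP yP]] := sP (slot_of p).
  by exists y; split=> // d /yP/eqP.
apply/existsP; exists [ffun p => s (slot_of p)]; apply/existsP; exists [ffun p => q p].
apply/and3P; split.
- by apply/injectiveP => p p'; rewrite !ffunE => /s_inj/(can_inj frameK).
- by apply/forallP => p; rewrite !ffunE; case: (qP p).
apply/forallP => d; apply/existsP; exists (face_color t d); apply/forallP => p.
apply/implyP; rewrite -{1}(frameK p) ffunE => /outer_face_slot dp.
by case: (qP p) => _ ->.
Qed.

Lemma can_build_leq n N (c : {ffun 'I_N -> cube}) :
  can_build n c -> #|{: frame n}| <= N.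
Proof.
case/existsP=> s /existsP[q /and3P[/injectiveP s_inj _ _]].
by rewrite -[leqRHS]card_ord; apply: leq_card s_inj.
Qed.

Theorem theoremB (n : nat) (hn : 4 <= n) : fr n = 12 * n - 16.
Proof.
case: n hn => [|[|k]] // k_gt1; have -> : 12 * k.+2 - 16 = 12 * k + 8 by lia.
rewrite /fr; case: ex_minnP => N buildN minN; apply/eqP; rewrite eqn_leq.
apply/andP; split; first by apply: minN; apply/forallP => c; apply: build_frame.
have [x _] := exists_cube_of_variety ord0.
by rewrite -card_frame; apply: can_build_leq (forallP buildN [ffun=> x]).
Qed.
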